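(* Let $m\in\mathbb{N}$, let $\mathcal{B}$ be the Segal-Bargmann transform and let $V_\varphi$ be the short-time Fourier transform with window $\varphi(\underline{x})=e^{-\frac{|\underline{x}|^2}{4}}$. Then for all $f\in L^2(\mathbb{R}^m,\mathbb{R})$ and all $\underline{t},\underline{\omega}\in\mathbb{R}^m$, $$(V_\varphi f)(2\underline{t},-\underline{\omega})=e^{-\frac{|\underline{z}|^2}{2}}\,e^{i\underline{t}\cdot\underline{\omega}}\,(\mathcal{B}f)(\underline{z}),\qquad \underline{z}=\underline{t}+i\underline{\omega}.$$
   Context: The short-time Fourier transform of $f$ with window $\varphi$ is $$(V_\varphi f)(\underline{t},\underline{\omega})=\frac{1}{\sqrt{2\pi}^{\,m}}\int_{\mathbb{R}^m}f(\underline{x})\,\overline{\varphi(\underline{x}-\underline{t})}\,e^{-i\underline{\omega}\cdot\underline{x}}\,d\underline{x},$$ with the bar denoting complex conjugation. The Segal-Bargmann transform is $$(\mathcal{B}f)(\underline{z})=\frac{1}{\sqrt{2\pi}^{\,m}}\int_{\mathbb{R}^m}e^{-\frac{\underline{z}\cdot\underline{z}}{2}+\underline{x}\cdot\underline{z}-\frac{\underline{x}\cdot\underline{x}}{4}}f(\underline{x})\,d\underline{x},\qquad\underline{z}\in\mathbb{C}^m,$$ where the dot denotes the bilinear product, $\underline{x}\cdot\underline{z}=\sum_jx_jz_j$ and $\underline{z}\cdot\underline{z}=\sum_jz_j^2$, while $|\underline{z}|^2=\sum_j|z_j|^2$. *)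

(* Defs.v *)
From HB Require Import structures.
From mathcomp Require Import all_boot all_order all_algebra.
From mathcomp Require Import all_classical all_reals all_analysis.
From mathcomp.real_closed Require Import complex.

Set Implicit Arguments.
Unset Strict Implicit.
Unset Printing Implicit Defensive.

Import Order.TTheory GRing.Theory Num.Theory.
Import numFieldNormedType.Exports.

Local Open Scope classical_set_scope.
Local Open Scope ring_scope.

(* R^m is 'rV[R]_m.  Its sigma-algebra is the product one, generated by the
   coordinate maps, as the library does for m.-tuple T; over R it is the Borel
   sigma-algebra. *)
Definition measure_rV_display : measure_display -> measure_display.
Proof. exact. Qed.

Section measurable_rV.
Context {d} {T : measurableType d}.
Variable n : nat.

Let coors : 'I_n -> 'rV[T]_n -> T := fun i x => x ord0 i.

Let rV_set0 : g_sigma_preimage coors set0.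
Proof. exact: sigma_algebra0. Qed.

Let rV_setC A : g_sigma_preimage coors A -> g_sigma_preimage coors (~` A).
Proof. exact: sigma_algebraC. Qed.

Let rV_bigcup (F : _^nat) : (forall i, g_sigma_preimage coors (F i)) ->
  g_sigma_preimage coors (\bigcup_i (F i)).
Proof. exact: sigma_algebra_bigcup. Qed.

HB.instance Definition _ := @isMeasurable.Build (measure_rV_display d)
  'rV[T]_n (g_sigma_preimage coors) rV_set0 rV_setC rV_bigcup.

End measurable_rV.

Section measurable_rV_lemmas.
Context d1 d2 (T1 : measurableType d1) (T2 : measurableType d2).

Lemma measurable_coord n (i : 'I_n) :
  measurable_fun [set: 'rV[T2]_n] (fun x : 'rV[T2]_n => x ord0 i).
Proof.
move=> _ Y mY; rewrite setTI; apply: sub_sigma_algebra => /=.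
rewrite -bigcup_seq/=; exists i => /=; first by rewrite mem_index_enum.
by exists Y => //; rewrite setTI.
Qed.

Lemma measurable_fun_rVP n (f : T1 -> 'rV[T2]_n) :
  measurable_fun [set: T1] f <->
  forall i, measurable_fun [set: T1] (fun x => f x ord0 i).
Proof.
split=> [mf i|mf].
  exact: (measurableT_comp (measurable_coord i) mf).
suff prefS : g_sigma_preimage
    (fun i => (fun x : 'rV[T2]_n => x ord0 i) \o f) `<=` measurable.
  move: prefS; rewrite g_sigma_preimage_comp => prefS _ A mA.
  by apply: prefS; exists A.
apply: smallest_sub; first exact: sigma_algebra_measurable.
case: n => [|n] in f mf *; first by rewrite big_ord0.
rewrite -bigcup_mkord_ord; apply: bigcup_sub => i Ii.
by move=> A [B mB <-]; exact: mf.
Qed.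

End measurable_rV_lemmas.

Section lebesgue_measure_rV.
Context {R : realType}.

Definition cons_rV n (p : measurableTypeR R * 'rV[R]_n) : 'rV[R]_n.+1 :=
  row_mx (const_mx p.1 : 'rV[R]_1) p.2.

Lemma cons_rV0 n (p : measurableTypeR R * 'rV[R]_n) : cons_rV p ord0 ord0 = p.1.
Proof.
rewrite /cons_rV (_ : ord0 = lshift n (ord0 : 'I_1)); last exact/val_inj.
by rewrite (@row_mxEl _ 1 1 n) mxE.
Qed.

Lemma cons_rVS n (p : measurableTypeR R * 'rV[R]_n) i :
  cons_rV p ord0 (lift ord0 i) = p.2 ord0 i.
Proof.
rewrite /cons_rV (_ : lift ord0 i = rshift 1 i); last exact/val_inj.
by rewrite (@row_mxEr _ 1 1 n).
Qed.

Lemma measurable_cons_rV n :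
  measurable_fun [set: measurableTypeR R * 'rV[R]_n] (@cons_rV n).
Proof.
apply/measurable_fun_rVP => i; have [j ->|->] := unliftP ord0 i.
- under eq_fun do rewrite cons_rVS.
  exact: (measurableT_comp (measurable_coord j) measurable_snd).
- by under eq_fun do rewrite cons_rV0; exact: measurable_fst.
Qed.

Section step.
Variables (n : nat) (mu : {sigma_finite_measure set 'rV[R]_n -> \bar R}).

Definition lebesgue_measure_cons : set 'rV[R]_n.+1 -> \bar R :=
  pushforward (@lebesgue_measure R \x mu)%E (@cons_rV n).

Let lm0 : lebesgue_measure_cons set0 = 0%E.
Proof. by rewrite /lebesgue_measure_cons /pushforward preimage_set0 measure0. Qed.

Let lm_ge0 A : (0 <= lebesgue_measure_cons A)%E.
Proof. by rewrite /lebesgue_measure_cons /pushforward; exact: measure_ge0. Qed.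

Let lm_sigma_additive : semi_sigma_additive lebesgue_measure_cons.
Proof.
move=> F mF tF mUF; rewrite /lebesgue_measure_cons /pushforward preimage_bigcup.
apply: measure_semi_sigma_additive.
- by move=> k; rewrite -[X in measurable X]setTI; exact: measurable_cons_rV.
- apply/trivIsetP => /= i j _ _ ij; rewrite -preimage_setI.
  by move/trivIsetP : tF => /(_ _ _ _ _ ij) ->//; rewrite preimage_set0.
- by rewrite -preimage_bigcup -[X in measurable X]setTI; exact: measurable_cons_rV.
Qed.

HB.instance Definition _ := isMeasure.Build _ _ _
  lebesgue_measure_cons lm0 lm_ge0 lm_sigma_additive.

Let uncons (x : 'rV[R]_n.+1) : measurableTypeR R * 'rV[R]_n :=
  (x ord0 ord0, \row_i x ord0 (lift ord0 i)).

Let uncons_cons p : uncons (cons_rV p) = p.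
Proof.
case: p => a v; rewrite /uncons cons_rV0; congr pair.
by apply/rowP => i; rewrite mxE cons_rVS.
Qed.

Let measurable_uncons : measurable_fun setT uncons.
Proof.
apply/measurable_fun_pairP; split; first exact: measurable_coord.
apply/measurable_fun_rVP => i.
by under eq_fun do rewrite mxE; exact: measurable_coord.
Qed.

Let lm_sigma_finite : sigma_finite setT lebesgue_measure_cons.
Proof.
have /sigma_finiteP[F [TF ndF Foo]] := sigma_finiteT (@lebesgue_measure R).
have /sigma_finiteP[G [TG ndG Goo]] := sigma_finiteT mu.
exists (fun k => uncons @^-1` (F k `*` G k)).
  rewrite -preimage_bigcup (_ : \bigcup_k _ = setT) ?preimage_setT//.
  rewrite -setXTT TF TG predeqE => -[x y]; split.
    by move=> [k _ []/= ? ?]; split; exists k.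
  move=> [/= [k _ Fkx] [l _ Gly]]; exists (maxn k l) => //; split.
  - by move: x Fkx; exact/subsetPset/ndF/leq_maxl.
  - by move: y Gly; exact/subsetPset/ndG/leq_maxr.
move=> k; have [mF Fk] := Foo k; have [mG Gk] := Goo k; split.
  by rewrite -[X in measurable X]setTI; apply: measurable_uncons => //; exact: measurableX.
rewrite /lebesgue_measure_cons /pushforward.
rewrite (_ : _ @^-1` _ = F k `*` G k).
  by rewrite product_measure1E// lte_mul_pinfty// ge0_fin_numE.
by apply/seteqP; split => p; rewrite /preimage /mkset uncons_cons.
Qed.

HB.instance Definition _ := Measure_isSigmaFinite.Build _ _ _
  lebesgue_measure_cons lm_sigma_finite.

End step.

Fixpoint lebesgue_measure_rV n : {sigma_finite_measure set 'rV[R]_n -> \bar R} :=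
  match n with
  | 0 => dirac (0 : 'rV[R]_0)
  | n'.+1 => lebesgue_measure_cons (lebesgue_measure_rV n')
  end.

Lemma lebesgue_measure_rV_box n (A : 'I_n -> set R) :
  (forall i, measurable (A i)) ->
  lebesgue_measure_rV n [set x | forall i, A i (x ord0 i)] =
  (\prod_(i < n) lebesgue_measure (A i))%E.
Proof.
elim: n A => [|n IHn] A mA.
  rewrite big_ord0 /= diracE mem_set//=; by case.
rewrite big_ord_recl /= /lebesgue_measure_cons /pushforward.
pose B : set 'rV[R]_n := [set x | forall i, A (lift ord0 i) (x ord0 i)].
have mB : measurable B.
  rewrite (_ : B = \big[setI/setT]_(i < n)
      ((fun x : 'rV[R]_n => x ord0 i) @^-1` A (lift ord0 i))).
    apply: bigsetI_measurable => i _.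
    by rewrite -[X in measurable X]setTI; exact: measurable_coord.
  apply/seteqP; split => x /=; rewrite -bigcap_seq /= /B /=.
    by move=> + i _; apply.
  by move=> + i; apply => /=; rewrite mem_index_enum.
rewrite (_ : _ @^-1` _ = A ord0 `*` B).
  have E := @product_measure1E _ _ _ _ _ (@lebesgue_measure R)
    (lebesgue_measure_rV n) _ _ (mA ord0) mB.
  apply: etrans E _.
  by congr (_ * _)%E; exact: IHn.
apply/seteqP; split => [p /= Ap|p /= [p1 p2] i].
  split; first by have := Ap ord0; rewrite cons_rV0.
  by move=> i; have := Ap (lift ord0 i); rewrite cons_rVS.
by have [j ->|->] := unliftP ord0 i; rewrite ?cons_rVS ?cons_rV0.
Qed.

End lebesgue_measure_rV.

Section transforms.
Context {R : realType}.
Local Notation Re := complex.Re.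
Local Notation Im := complex.Im.
Local Open Scope complex_scope.

Definition cexp (z : R[i]) : R[i] :=
  (expR (Re z))%:C * (cos (Im z) +i* sin (Im z)).

(* Only meaningful when the real and imaginary parts of f are integrable, since
   Rintegral sends infinite values to 0. *)
Definition cintegral m (f : 'rV[R]_m -> R[i]) : R[i] :=
  (\int[lebesgue_measure_rV m]_x Re (f x)) +i*
  (\int[lebesgue_measure_rV m]_x Im (f x)).

(* The bilinear product: no conjugation, also over R[i]. *)
Definition dot (K : comPzRingType) m (u v : 'rV[K]_m) : K :=
  \sum_(j < m) u ord0 j * v ord0 j.

(* The squared Euclidean norm; the library's norm on 'rV[R]_m is the sup norm. *)
Definition sqnorm (K : numDomainType) m (u : 'rV[K]_m) : K :=
  \sum_(j < m) `|u ord0 j| ^+ 2.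

Definition complex_rV m (x : 'rV[R]_m) : 'rV[R[i]]_m := \row_j (x ord0 j)%:C.

Definition stft m (phi f : 'rV[R]_m -> R[i]) (t w : 'rV[R]_m) : R[i] :=
  ((Num.sqrt (2 * pi) ^+ m)^-1)%:C *
  cintegral (fun x => f x * (phi (x - t))^*%C * cexp (- ('i%C * (dot w x)%:C))).

Definition segal_bargmann m (f : 'rV[R]_m -> R[i]) (z : 'rV[R[i]]_m) : R[i] :=
  ((Num.sqrt (2 * pi) ^+ m)^-1)%:C *
  cintegral (fun x =>
    cexp (- (dot z z / 2) + dot (complex_rV x) z - (dot x x / 4)%:C) * f x).

Definition gaussian_window m (x : 'rV[R]_m) : R[i] :=
  (expR (- (sqnorm x / 4)))%:C.

End transforms.

(* Main.v *)
(** The two integrands agree pointwise up to the constant factor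
    exp(-|z|^2/2) e^(i t.w): once it is absorbed into the Bargmann kernel, both
    have exponent -|x - 2t|^2/4 + i w.x.  Taking
    this constant out of the integral needs integrability; the integrand is
    f times a translated Gaussian times a phase, hence it is dominated by the
    sum of |f|^2 and the squared Gaussian, which is a product of
    one-dimensional Gaussians and so integrable by Tonelli. *)
Require Import Defs.
From mathcomp Require Import all_boot all_order all_algebra.
From mathcomp Require Import all_classical all_reals all_analysis.
From mathcomp.real_closed Require Import complex.
From mathcomp Require Import measurable_realfun ring lra.

Import Order.TTheory GRing.Theory Num.Theory.
Import numFieldNormedType.Exports.
Local Open Scope ring_scope.
Local Open Scope complex_scope.

(** Induction on [n]: the measure in dimension [n.+1] is the image of a product measure under
    [cons_rV], so Tonelli splits off the first coordinate. *)
Lemma ge0_integral_prod_rV (R : realType) (n : nat) (g : 'I_n -> R -> R) :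
    (forall i, measurable_fun setT (g i)) -> (forall i x, 0 <= g i x) ->
  (\int[lebesgue_measure_rV n]_x (\prod_(i < n) g i (x ord0 i))%:E =
   \prod_(i < n) \int[lebesgue_measure]_y (g i y)%:E)%E.
Proof.
elim: n g => [|n IHn] g mg g0.
  (* In dimension 0 the measure is a Dirac mass and the integrand is the empty product 1. *)
  rewrite big_ord0 /=.
  under eq_integral do rewrite big_ord0.
  by rewrite integral_cst// mul1e /= diracE in_setT.
have m_coord k (h : 'I_k -> R -> R) : (forall i, measurable_fun setT (h i)) ->
    measurable_fun setT (EFin \o fun x : 'rV[R]_k => \prod_(i < k) h i (x ord0 i)).
  move=> mh; apply/measurable_EFinP; apply: measurable_prod => i _.
  exact: (measurableT_comp (mh i) (measurable_coord i)).
have h_ge0 (x : 'rV[R]_n) : 0 <= \prod_(i < n) g (lift ord0 i) (x ord0 i).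
  by apply: prodr_ge0 => i _; exact: g0.
rewrite big_ord_recl -(IHn (fun i => g (lift ord0 i)))//.
rewrite [LHS](ge0_integral_pushforward (@measurable_cons_rV R n))//; first last.
- by move=> x _; rewrite lee_fin; apply: prodr_ge0 => i _; exact: g0.
- exact: m_coord.
rewrite preimage_setT fubini_tonelli1//; first last.
- by move=> p; rewrite /= lee_fin; apply: prodr_ge0 => i _; exact: g0.
- exact: (measurableT_comp (m_coord _ _ mg) (@measurable_cons_rV R n)).
rewrite /fubini_F.
(* For fixed [y] the first factor is constant in the inner integral; what remains of that integral
   does not depend on [y]. *)
under eq_integral => y _.
  under eq_integral => x _ do [rewrite /= big_ord_recl cons_rV0 /=;
    under eq_bigr do rewrite cons_rVS /=; rewrite EFinM].
  rewrite ge0_integralZl//=; first last.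
  - by rewrite lee_fin g0.
  - by move=> x _; rewrite lee_fin.
  - by apply: (m_coord n (fun i => g (lift ord0 i))).
  over.
rewrite /= ge0_integralZr//.
- by apply/measurable_EFinP; exact: mg.
- by move=> y _; rewrite lee_fin g0.
- by apply: integral_ge0 => x _; rewrite lee_fin.
Qed.

Section cexp.
Context {R : realType}.
Implicit Types (x y : R[i]).

Lemma cexpD x y : cexp (x + y) = cexp x * cexp y.
Proof.
case: x y => [a b] [c d]; apply/eqP; rewrite eq_complex /cexp /=.
by rewrite expRD cosD sinD; apply/andP; split; apply/eqP; ring.
Qed.

Lemma cexp0 : cexp 0 = 1 :> R[i].
Proof.
by apply/eqP; rewrite eq_complex /cexp /= expR0 cos0 sin0; apply/andP; split;
  apply/eqP; ring.
Qed.

Lemma cexp_real (a : R) : cexp a%:C = (expR a)%:C.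
Proof.
by apply/eqP; rewrite eq_complex /cexp /= cos0 sin0; apply/andP; split;
  apply/eqP; ring.
Qed.

End cexp.

Section cintegral.
Context {R : realType} {m : nat}.
Local Notation mu := (@lebesgue_measure_rV R m).
Local Notation Re := complex.Re.
Local Notation Im := complex.Im.

(** Multiplication by [c] mixes real and imaginary parts, so both must be integrable for the two
    real integrals to split. *)
Lemma cintegralZl (c : R[i]) (g : 'rV[R]_m -> R[i]) :
    mu.-integrable setT (EFin \o (fun x => Re (g x))) ->
    mu.-integrable setT (EFin \o (fun x => Im (g x))) ->
  cintegral (fun x => c * g x) = c * cintegral g.
Proof.
move=> iRe iIm; case: c => a b; rewrite /cintegral.
have ReE x : Re ((a +i* b) * g x) = a * Re (g x) - b * Im (g x).
  by case: (g x).
have ImE x : Im ((a +i* b) * g x) = a * Im (g x) + b * Re (g x).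
  by case: (g x).
have iZ k (h : 'rV[R]_m -> R) : mu.-integrable setT (EFin \o h) ->
    mu.-integrable setT (EFin \o (fun x => k * h x)).
  by move=> ih; exact: (integrableZl measurableT k ih).
under eq_Rintegral do rewrite ReE.
under [X in _ +i* X]eq_Rintegral do rewrite ImE.
rewrite RintegralB//; [|exact: iZ|exact: iZ].
rewrite RintegralD//; [|exact: iZ|exact: iZ].
by rewrite !RintegralZl.
Qed.

End cintegral.

Section gaussian.
Context {R : realType}.

(** The integrand is a constant multiple of the normal density with mean [a] and variance 1, whose
    integral is 1. *)
Lemma integral_gaussian_lty (a : R) :
  (\int[lebesgue_measure]_x (expR (- ((x - a) ^+ 2 / 2)))%:E < +oo)%E.
Proof.
have peak_gt0 : 0 < normal_peak (1 : R) by exact: normal_peak_gt0.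
have E x : expR (- ((x - a) ^+ 2 / 2)) = (normal_peak 1)^-1 * normal_pdf a 1 x.
  rewrite normal_pdfE ?oner_neq0// mulKf ?gt_eqF// /normal_fun mulNr.
  by rewrite expr1n.
under eq_integral do rewrite E EFinM.
rewrite ge0_integralZl_EFin//.
- by rewrite integral_normal_pdf mule1 ltry.
- by move=> x _; rewrite lee_fin normal_pdf_ge0.
- by apply/measurable_EFinP; exact: measurable_normal_pdf.
- by rewrite invr_ge0 ltW.
Qed.

Lemma sqnormE n (x : 'rV[R]_n) : sqnorm x = \sum_(j < n) x ord0 j ^+ 2.
Proof. by apply: eq_bigr => j _; rewrite real_normK// num_real. Qed.

Lemma measurable_sqnormB n (a : 'rV[R]_n) :
  measurable_fun setT (fun x : 'rV[R]_n => sqnorm (x - a)).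
Proof.
under eq_fun do rewrite sqnormE.
apply: measurable_sum => i; apply: measurable_funX.
under eq_fun do rewrite !mxE.
by apply: measurable_funB => //; exact: measurable_coord.
Qed.

Lemma measurable_dot n (a : 'rV[R]_n) :
  measurable_fun setT (fun x : 'rV[R]_n => dot a x).
Proof.
apply: measurable_sum => i.
by apply: measurable_funM => //; exact: measurable_coord.
Qed.

(** Squaring turns the factor 1/4 in the exponent into 1/2, which leaves a product of
    one-dimensional Gaussians of variance 1. *)
Lemma integrable_sqr_gaussian n (a : 'rV[R]_n) :
  (lebesgue_measure_rV n).-integrable setT
    (fun x => (expR (- (sqnorm (x - a) / 4)) ^+ 2)%:E).
Proof.
have E x : expR (- (sqnorm (x - a) / 4)) ^+ 2 =
    \prod_(i < n) expR (- ((x ord0 i - a ord0 i) ^+ 2 / 2)).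
  rewrite -expR_sum -expRM_natl sqnormE sumrN -mulr_suml; congr expR.
  rewrite (eq_bigr (fun i => (x ord0 i - a ord0 i) ^+ 2)) => [|i _].
    by field.
  by rewrite !mxE.
apply/integrableP; split.
  apply/measurable_EFinP; apply: measurable_funX; apply: measurableT_comp => //.
  apply: measurableT_comp => //; apply: measurable_funM => //.
  exact: measurable_sqnormB.
under eq_integral => x _ do rewrite gee0_abs ?lee_fin ?sqr_ge0// E.
rewrite (@ge0_integral_prod_rV R n (fun i y => expR (- ((y - a ord0 i) ^+ 2 / 2)))).
- suff : (\prod_(i < n) \int[lebesgue_measure]_y
      (expR (- ((y - a ord0 i) ^+ 2 / 2)))%:E)%E \is a fin_num by rewrite ltey_eq => ->.
  elim/big_ind : _ => [//|u v|i _]; first exact: fin_numM.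
  rewrite ge0_fin_numE ?integral_gaussian_lty//.
  by apply: integral_ge0 => y _; rewrite lee_fin expR_ge0.
- move=> i; apply: measurableT_comp => //; apply: measurableT_comp => //.
  by apply: measurable_funM => //; apply: measurable_funX; exact: measurable_funB.
- by move=> i y; exact: expR_ge0.
Qed.

(** The bounded factor [u] will be the cosine or sine of the phase; the dominating function is the
    sum of the squares of [f] and of the Gaussian. *)
Lemma integrable_mul_gaussian n (f u : 'rV[R]_n -> R) (a : 'rV[R]_n) :
    f \in Lfun (lebesgue_measure_rV n) 2%:E -> measurable_fun setT u ->
    (forall x, `|u x| <= 1) ->
  (lebesgue_measure_rV n).-integrable setT
    (EFin \o (fun x => f x * expR (- (sqnorm (x - a) / 4)) * u x)).
Proof.
move=> fL mu u1; pose G x := expR (- (sqnorm (x - a) / 4)).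
have mf : measurable_fun setT f by move: fL; rewrite inE => /andP[/[!inE]].
have mG : measurable_fun setT G.
  apply: measurableT_comp => //; apply: measurableT_comp => //.
  by apply: measurable_funM => //; exact: measurable_sqnormB.
apply: (le_integrable measurableT _ _
  (integrableD measurableT (Lfun2_integrable_sqr fL) (integrable_sqr_gaussian _ a))).
  by apply/measurable_EFinP; apply: measurable_funM => //; exact: measurable_funM.
move=> x _; rewrite -EFinD !abse_EFin lee_fin -/(G x).
rewrite [leRHS]ger0_norm ?addr_ge0 ?sqr_ge0// !normrM.
apply: (@le_trans _ _ (`|f x| * `|G x|)); first exact: ler_piMr.
rewrite -(real_normK (num_real (f x))) -(real_normK (num_real (G x))).
(* This gives twice the product below the sum of squares; nonnegativity of the product removes the
   factor 2. *)
have := sqr_ge0 (`|f x| - `|G x|).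
have := mulr_ge0 (normr_ge0 (f x)) (normr_ge0 (G x)).
nra.
Qed.

End gaussian.

Section exponents.
Context {R : realType}.

(** Coordinatewise, the squares of [w] in [sqnorm z] and [dot z z] cancel, and the term in [dot t w]
    cancels the cross term of [dot z z / 2]. *)
Lemma stft_exponentE m (t w x : 'rV[R]_m) (z := complex_rV t + 'i *: complex_rV w) :
  - ((sqnorm (x - 2 *: t) / 4)%:C) - 'i * (dot (- w) x)%:C =
  (- (sqnorm z / 2) + 'i * (dot t w)%:C) +
  (- (dot z z / 2) + dot (complex_rV x) z - (dot x x / 4)%:C).
Proof.
have four : (4 : R[i]) = (4 : R)%:C by rewrite rmorph_nat.
have zE j : z ord0 j = (t ord0 j)%:C + 'i * (w ord0 j)%:C by rewrite !mxE.
have zJ j : (z ord0 j)^* = (t ord0 j)%:C - 'i * (w ord0 j)%:C.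
  by rewrite zE; apply/eqP; rewrite eq_complex /=; apply/andP; split; apply/eqP; ring.
rewrite sqnormE /sqnorm /dot !rmorphM /= !fmorphV /= -four !rmorph_sum /=.
rewrite !mulr_suml !mulr_sumr -!sumrN -!big_split /=.
apply: eq_bigr => j _.
rewrite sqr_normc zJ !zE !mxE !(rmorphM, rmorphB, rmorphN) rmorph_nat /=.
by field.
Qed.

End exponents.

Theorem proposition4p3 (R : realType) (m : nat) (f : 'rV[R]_m -> R)
    (hf : f \in Lfun (lebesgue_measure_rV m) 2%:E) (t w : 'rV[R]_m) :
  let z : 'rV[R[i]]_m := complex_rV t + 'i%C *: complex_rV w in
  stft (@gaussian_window R m) (fun x => (f x)%:C) (2 *: t) (- w) =
  cexp (- (sqnorm z / 2)) * cexp ('i%C * (dot t w)%:C) *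
    segal_bargmann (fun x => (f x)%:C) z.
Proof.
move=> z; rewrite /stft /segal_bargmann -cexpD mulrCA; congr (_ * _).
set a := - _ + _; set g := fun x => _ * _ * _.
(* Both components have the form required by [integrable_mul_gaussian]. *)
have gE x : g x = (f x * expR (- (sqnorm (x - 2 *: t) / 4)) * cos (- dot (- w) x))
      +i* (f x * expR (- (sqnorm (x - 2 *: t) / 4)) * sin (- dot (- w) x)).
  apply/eqP; rewrite eq_complex /g /cexp /gaussian_window /=.
  by apply/andP; split; apply/eqP; rewrite ?(mul0r, mul1r, subr0, oppr0, expR0, add0r); ring.
have m_phase (h : R -> R) : measurable_fun setT h ->
    measurable_fun setT (fun x : 'rV[R]_m => h (- dot (- w) x)).
  move=> mh; apply: measurableT_comp => //; apply: measurableT_comp => //.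
  exact: measurable_dot.
(* The Bargmann integrand is expressed through [g], so that integrability has to be checked for [g]
   alone. *)
under [in RHS]eq_fun => x.
  rewrite (_ : cexp _ * _ = cexp (- a) * g x); last first.
    rewrite /g /gaussian_window conjc_real -cexp_real -mulrA -cexpD.
    rewrite rmorphN stft_exponentE -/z -/a mulrCA -cexpD addKr mulrC//.
  over.
rewrite cintegralZl.
- by rewrite mulrA -cexpD subrr cexp0 mul1r.
- under eq_fun do rewrite gE /=.
  apply: integrable_mul_gaussian => // [|x]; last exact: cos_max.
  exact: (m_phase _ (continuous_measurable_fun (@continuous_cos R))).
- under eq_fun do rewrite gE /=.
  apply: integrable_mul_gaussian => // [|x]; last exact: sin_max.
  exact: (m_phase _ (continuous_measurable_fun (@continuous_sin R))).
Qed.
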